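(* Let $F$ be a connected graph of girth $3$ (i.e. $F$ contains a triangle). Then $$n^2e^{-O(\sqrt{\log n})}\le \mathrm{ex}_{F}(n,K_3)=o(n^2)\qquad (n\to\infty).$$
   Context: For fixed nonempty simple graphs $F$ and $G$, $\mathrm{ex}_F(n,G)$ denotes the maximum number of pairwise edge-disjoint copies of $F$ that can be placed on an $n$-element vertex set so that the union of these copies contains no subgraph isomorphic to $G$ all of whose edges belong to pairwise different copies of $F$. $K_3$ is the triangle. *)

(* Defs.v *)
From mathcomp Require Import all_boot.

Set Implicit Arguments.
Unset Strict Implicit.
Unset Printing Implicit Defensive.

Record sgraph := SGraph {
  vertex :> finType;
  adj : rel vertex;
  adj_sym : symmetric adj;
  adj_irrefl : irreflexive adj }.
Arguments adj {s}.

Definition edges (G : sgraph) : {set {set G}} :=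
  [set [set p.1; p.2] | p : G * G & adj p.1 p.2].

Lemma complete_sym n : symmetric (fun i j : 'I_n => i != j).
Proof. by move=> i j; rewrite eq_sym. Qed.

Lemma complete_irrefl n : irreflexive (fun i j : 'I_n => i != j).
Proof. by move=> i; rewrite eqxx. Qed.

Definition complete (n : nat) : sgraph :=
  SGraph (@complete_sym n) (@complete_irrefl n).

Definition connected_graph (G : sgraph) : Prop :=
  0 < #|G| /\ forall x y : G, connect adj x y.

(* The bound on the length is needed because [ucycle] also accepts the empty
   sequence and the closed walk x, y, x along a single edge. *)
Definition is_graph_cycle (G : sgraph) (c : seq G) : Prop :=
  2 < size c /\ ucycle adj c.

Definition has_girth (G : sgraph) (g : nat) : Prop :=
  (exists2 c : seq G, is_graph_cycle c & size c = g) /\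
  (forall c : seq G, is_graph_cycle c -> g <= size c).

(* A copy is a not necessarily induced subgraph, recorded by its edge set. When
   F has an edge this loses nothing for families of edge-disjoint copies:
   distinct members of such a family have distinct edge sets. Isolated vertices
   of F still need room, since the whole vertex set of F is injected. *)
Definition copies (F : sgraph) (n : nat) : {set {set {set 'I_n}}} :=
  [set [set f @: a | a : {set F} in edges F] | f : {ffun F -> 'I_n} & injectiveb f].

Section MulticolorTuran.
Variables (F G : sgraph) (n : nat).

(* D is contained in the union of the members of H, and no member of H contains
   two edges of D. *)
Definition rainbow (H : {set {set {set 'I_n}}}) (D : {set {set 'I_n}}) : bool :=
  (D \subset cover H) && [forall C in H, #|C :&: D| <= 1].

Definition rainbow_free_packing (H : {set {set {set 'I_n}}}) : bool :=
  [&& H \subset copies F n, trivIset H &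
      ~~ [exists D in copies G n, rainbow H D]].

Definition multicolor_ex : nat :=
  \max_(H : {set {set {set 'I_n}}} | rainbow_free_packing H) #|H|.

End MulticolorTuran.

(* Main.v *)
Require Import Defs.
From HB Require Import structures.
From mathcomp Require Import all_boot all_order all_algebra.
From mathcomp Require Import zify ring.
Import Order.TTheory GRing.Theory Num.Theory.

Set Implicit Arguments.
Unset Strict Implicit.
Unset Printing Implicit Defensive.

(** Upper bound. Choosing one triangle in each copy gives edge-disjoint triangles
    whose union has no further triangle (it would be rainbow), so the claim is
    the Ruzsa-Szemeredi theorem. For it, consider step functions
    [u x y = U (f x) (f y)] and the bounded energy
    [q * #(edges in u) - #(pairs in u)]. If there are at least [4 n^2 / q]
    ordered edges, most of them lie in pairs of parts that are dense and in which
    some neighbourhood [N z] meets both parts in a proportion at least [1/q].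
    Since [N z] spans only a matching, removing the rectangle
    [N z * N z] from [u] there raises the energy by a fixed fraction of [n^2],
    at the cost of a bounded refinement of [f]; this cannot be iterated forever.

    Lower bound (Behrend). On the vertex set [F * [0, r L)^d], place a copy
    [v |-> (v, x + v a)] for every [x] in [[0, L)^d] and every [a] on a sphere.
    A triangle with edges from the copies [(x_i, a_i)] yields a relation
    [p a_1 + q a_2 = (p + q) a_3] with nonzero [p], [q], and strict convexity of
    the sphere forces the three copies to coincide. *)

(** * Ruzsa-Szemeredi theorem: counting ordered pairs *)

Section RuzsaSzemeredi.
Variables (T : finType) (e : rel T) (q : nat).
Hypothesis e_sym : symmetric e.
Hypothesis e_tri : forall x y, e x y -> exists z, e z x && e z y.
Hypothesis e_uniq : forall x y z z',
  e x y -> e z x -> e z y -> e z' x -> e z' y -> z = z'.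

Let cnt (P : T -> T -> bool) := #|[set p : T * T | P p.1 p.2]|.

Lemma cnt_sum (P : T -> T -> bool) : cnt P = \sum_x #|[set y | P x y]|.
Proof.
rewrite /cnt -sum1_card (eq_bigl (fun p : T * T => true && P p.1 p.2)); last first.
  by move=> p; rewrite inE.
rewrite -(pair_big_dep xpredT P (fun _ _ => 1)) /=.
by apply: eq_bigr => x _; rewrite -sum1_card; apply: eq_bigl => y; rewrite inE.
Qed.

Lemma leq_cnt (P Q : T -> T -> bool) : (forall x y, P x y -> Q x y) -> cnt P <= cnt Q.
Proof. by move=> PQ; apply/subset_leq_card/subsetP => p; rewrite !inE; apply: PQ. Qed.

Lemma cntT : cnt (fun _ _ => true) = #|T| ^ 2.
Proof.
rewrite cnt_sum (eq_bigr (fun=> #|T|)) ?sum_nat_const // => x _.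
by rewrite -cardsT; apply: eq_card => y; rewrite !inE.
Qed.

Lemma leq_cntD (P Q S : T -> T -> bool) : (forall x y, P x y -> Q x y || S x y) ->
  cnt P <= cnt Q + cnt S.
Proof.
move=> PQ; apply: leq_trans (leq_card_setU _ _); apply/subset_leq_card/subsetP => p.
by rewrite !inE; apply: PQ.
Qed.

Lemma cnt_splitI (P Q : T -> T -> bool) :
  cnt P = cnt (fun x y => P x y && Q x y) + cnt (fun x y => P x y && ~~ Q x y).
Proof.
rewrite /cnt -(cardsID [set p | Q p.1 p.2]); congr (_ + _); apply: eq_card => p;
by rewrite !inE // andbC.
Qed.

Lemma cnt_swap (P : T -> T -> bool) : cnt (fun x y => P y x) = cnt P.
Proof.
have inj : injective (fun p : T * T => (p.2, p.1)) by move=> [? ?] [? ?] [-> ->].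
rewrite /cnt -(card_imset _ inj); apply: eq_card => -[x y].
rewrite inE /=; apply/imsetP/idP => [[[x' y']]|Pxy]; first by rewrite inE => ? [-> ->].
by exists (y, x); rewrite ?inE.
Qed.

Lemma cnt_rect (A B : {pred T}) : cnt (fun x y => (x \in A) && (y \in B)) = #|A| * #|B|.
Proof.
rewrite -cardX /cnt cardsE; apply: eq_card => -[x y].
by rewrite !inE.
Qed.

Lemma cnt_block (K : finType) (f : T -> K) (P : T -> T -> bool) :
  cnt P = \sum_(ij : K * K) cnt (fun x y => [&& f x == ij.1, f y == ij.2 & P x y]).
Proof.
rewrite /cnt -sum1_card (partition_big (fun p => (f p.1, f p.2)) xpredT) //=.
apply: eq_bigr => -[i j] _; rewrite -sum1_card; apply: eq_bigl => p.
by rewrite !inE /= xpair_eqE andbC andbA.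
Qed.

(** * Energy increment: one refinement of a partition *)

Section Refine.
Variables (K : finType) (f : T -> K) (U : rel K).

Let part i := [set x | f x == i].
Let nb i z := [set x | (f x == i) && e z x].
Let wt (ij : K * K) := cnt (fun x y => [&& f x == ij.1, f y == ij.2 & true]).
Let ed (ij : K * K) := cnt (fun x y => [&& f x == ij.1, f y == ij.2 & e x y]).
(* The pairs of parts whose indicator contributes positively to
   [q * (edges) - (pairs)]. *)
Let dense i j := wt (i, j) < q * ed (i, j).
Let thin z x := q * #|nb (f x) z| < #|part (f x)|.
(** A vertex whose neighbourhood is thin on neither part, if there is one. It depends only on the
    pair of parts, so membership in all the chosen neighbourhoods costs one bit per pair. *)
Let wit i j := [pick z | (#|part i| <= q * #|nb i z|) && (#|part j| <= q * #|nb j z|)].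
Let hit i j x := if wit i j is Some z then e z x else false.
Let hit2 x y := hit (f x) (f y) x && hit (f x) (f y) y.

(** The energy is a sum over pairs of parts, and [dense] keeps exactly the positive terms, so no
    other [U] does better. Negative terms are moved across to stay in the natural numbers. *)
Lemma dense_opt :
  q * cnt (fun x y => U (f x) (f y) && e x y) + cnt (fun x y => dense (f x) (f y)) <=
  q * cnt (fun x y => dense (f x) (f y) && e x y) + cnt (fun x y => U (f x) (f y)).
Proof.
have B (V : rel K) (P : T -> T -> bool) : cnt (fun x y => V (f x) (f y) && P x y) =
    \sum_(ij : K * K) V ij.1 ij.2 * cnt (fun x y => [&& f x == ij.1, f y == ij.2 & P x y]).
  rewrite (cnt_block f); apply: eq_bigr => -[i j] _ /=.
  case: (boolP (V i j)) => Vij; rewrite ?mul1n ?mul0n.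
    apply: eq_card => -[x y]; rewrite !inE /=.
    by do 2!case: eqP => //= ->; rewrite Vij.
  apply: eq_card0 => -[x y]; rewrite !inE /=.
  by do 2!case: eqP => //= ->; rewrite (negPf Vij).
have B1 (V : rel K) : cnt (fun x y => V (f x) (f y)) =
    \sum_(ij : K * K) V ij.1 ij.2 * wt ij.
  by rewrite -B; apply: eq_card => p; rewrite !inE andbT.
rewrite !B !B1 !big_distrr -!big_split /=; apply: leq_sum => -[i j] _ /=.
rewrite -/(ed (i, j)) /dense.
case: ltnP => H; case: (U i j); rewrite ?mul1n ?mul0n ?muln0 ?addn0 ?add0n //; exact: ltnW.
Qed.

Lemma sparse_edges : q * cnt (fun x y => ~~ dense (f x) (f y) && e x y) <= #|T| ^ 2.
Proof.
rewrite -cntT !(cnt_block f) big_distrr /=; apply: leq_sum => -[i j] _ /=.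
case: (boolP (dense i j)) => [D|].
  rewrite [cnt _](_ : _ = 0) ?muln0 //; apply: eq_card0 => -[x y]; rewrite !inE /=.
  by do 2!case: eqP => //= ->; rewrite D.
rewrite /dense -leqNgt; apply: leq_trans; rewrite leq_mul2l; apply/orP; right.
by apply: leq_cnt => x y /and3P[-> -> /andP[]].
Qed.

(* An edge [xy] is determined by [x] and the apex [z] of its triangle. *)
Lemma thin_edges : q * cnt (fun x y => e x y &&
  [exists z, [&& e z x, e z y & thin z x]]) <= #|T| ^ 2.
Proof.
pose R z x := e z x && thin z x.
apply: (@leq_trans (q * cnt R)).
  rewrite leq_mul2l; apply/orP; right.
  (* An edge goes to a thin apex and its first endpoint. The default [p.1] never occurs on the edges
     counted, and [e_uniq] recovers the second endpoint. *)
  pose g (p : T * T) := (odflt p.1 [pick z | [&& e z p.1, e z p.2 & thin z p.1]], p.1).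
  have gE x y : e x y && [exists z, [&& e z x, e z y & thin z x]] ->
      exists z, [/\ g (x, y) = (z, x), e x y, e z x, e z y & R z x].
    case/andP=> exy /existsP[z0 Hz0]; rewrite /g /=.
    case: pickP => [z|/(_ z0)]; last by rewrite Hz0.
    by case/and3P=> a b c; exists z; split => //; rewrite /R a c.
  rewrite /cnt -(card_in_imset (f := g)).
    apply/subset_leq_card/subsetP => w /imsetP[[x y]]; rewrite inE => /gE[z [-> _ _ _ Rz]] ->.
    by rewrite inE.
  move=> [x y] [x' y']; rewrite !inE => /gE[z [-> exy ezx ezy _]] /gE[z' [-> exy' ezx' ezy' _]].
  case=> ? ?; subst z' x'; congr pair.
  by apply: (e_uniq ezx); rewrite 1?(e_sym y) 1?(e_sym y').
(* For fixed [z], a part contains either no thin neighbour or fewer than a fraction [1/q] of its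
   points; sum over the parts, then over [z]. *)
rewrite cnt_sum big_distrr /= expnS expn1 -[leqRHS]sum_nat_const leq_sum // => z _.
rewrite -sum1_card (partition_big f xpredT) //= big_distrr /=.
rewrite -[leqRHS]sum1_card (partition_big f xpredT) //= leq_sum // => i _.
rewrite !sum1dep_card.
have [small|large] := ltnP (q * #|nb i z|) #|part i|.
  apply: leq_trans (leq_trans (ltnW small) _); last by [].
  rewrite leq_mul2l; apply/orP; right; apply/subset_leq_card/subsetP => x.
  by rewrite !inE /R => /andP[/andP[-> _] ->].
rewrite eq_card0 ?muln0 // => x; rewrite !inE /R.
apply: negbTE; apply/negP => /andP[/andP[_ +] /eqP fx]; rewrite /thin fx; lia.
Qed.

(** The apex of an edge would witness its pair of parts unless it is thin at one of the two
    endpoints; swapping the endpoints gives the factor 2. *)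
Lemma unwitnessed_edges : q * cnt (fun x y => ~~ wit (f x) (f y) && e x y) <= 2 * #|T| ^ 2.
Proof.
set X := cnt (fun x y => e x y && [exists z, [&& e z x, e z y & thin z x]]).
apply: (@leq_trans (q * (X + X))); last by have := thin_edges; rewrite -/X; lia.
rewrite leq_mul2l; apply/orP; right.
rewrite -[X in _ + X]cnt_swap; apply: leq_cntD => x y /andP[+ exy].
rewrite exy e_sym exy /wit; case: pickP => // H _.
have [z /andP[ezx ezy]] := e_tri exy.
have := H z; rewrite /= => /negbT; rewrite negb_and -!ltnNge => /orP[] lt.
  by apply/orP; left; apply/existsP; exists z; rewrite ezx ezy.
by apply/orP; right; apply/existsP; exists z; rewrite ezx ezy.
Qed.

Lemma good_edges : q * cnt (fun x y => e x y) <=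
  q * cnt (fun x y => [&& dense (f x) (f y), wit (f x) (f y) : bool & e x y]) + 3 * #|T| ^ 2.
Proof.
have := sparse_edges; have := unwitnessed_edges.
set A := cnt _; set B := cnt _; set C := cnt _; set D := cnt _ => ? ?.
suff : C <= D + (B + A) by move=> ?; nia.
apply: leq_trans (leq_cntD (Q := fun x y => [&& dense (f x) (f y), wit (f x) (f y) : bool & e x y])
  (S := fun x y => (~~ dense (f x) (f y) && e x y) || (~~ wit (f x) (f y) && e x y)) _) _.
  by move=> x y ->; rewrite !andbT; case: dense; case: (wit _ _).
by rewrite leq_add2l; apply: leq_cntD.
Qed.

(** The edges of a witnessed pair of parts are bounded by all its pairs, and the witness meets each
    of the two parts in a proportion at least [1/q]. *)
Lemma hit_pairs : cnt (fun x y => [&& dense (f x) (f y), wit (f x) (f y) : bool & e x y]) <=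
  q ^ 2 * cnt (fun x y => dense (f x) (f y) && hit2 x y).
Proof.
rewrite !(cnt_block f) big_distrr /=; apply: leq_sum => -[i j] _ /=.
case: (boolP (dense i j && wit i j)) => [/andP[dij]|Nij]; last first.
  rewrite [cnt _](_ : _ = 0) //; apply: eq_card0 => -[x y]; rewrite !inE /=.
  by do 2!case: eqP => //= ->; rewrite andbA (negPf Nij).
case E: (wit i j) => [z|] // _.
have [qi qj] : (#|part i| <= q * #|nb i z|) /\ (#|part j| <= q * #|nb j z|).
  by move: E; rewrite /wit; case: pickP => // z' /andP[? ?] [<-].
have /leq_trans: cnt (fun x y => [&& f x == i, f y == j &
    [&& dense (f x) (f y), wit (f x) (f y) : bool & e x y]]) <= #|part i| * #|part j|.
  by rewrite -cnt_rect; apply: leq_cnt => x y /and3P[? ? _]; rewrite !inE; apply/andP.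
apply; apply: leq_trans (leq_mul qi qj) _.
rewrite mulnACA mulnn leq_mul2l -cnt_rect; apply/orP; right; apply: leq_cnt => x y.
rewrite !inE => /andP[/andP[/eqP fx ezx] /andP[/eqP fy ezy]].
by rewrite fx fy !eqxx dij /hit2 /hit fx fy E ezx ezy.
Qed.

(* A neighbourhood spans a matching, hence at most [#|T|] ordered edges. *)
Lemma hit_edges : cnt (fun x y => [&& dense (f x) (f y), hit2 x y & e x y]) <=
  #|K| ^ 2 * #|T|.
Proof.
rewrite (cnt_block f) -[_ ^ 2]/(#|K| * #|K|) -card_prod -sum_nat_const.
apply: leq_sum => -[i j] _ /=; rewrite /hit2 /hit; case E: (wit i j) => [z|]; last first.
  rewrite [cnt _](_ : _ = 0) //; apply: eq_card0 => -[x y]; rewrite !inE /=.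
  by do 2!case: eqP => //= ->; rewrite E /= andbF.
apply: (@leq_trans (cnt (fun x y => [&& e z x, e z y & e x y]))).
  apply: leq_cnt => x y /and5P[/eqP -> /eqP -> _]; by rewrite E => /andP[-> ->] ->.
rewrite cnt_sum -sum1_card leq_sum // => x _.
apply/card_le1_eqP => y y'; rewrite !inE => /and3P[ezx ezy exy] /and3P[_ ezy' exy'].
by apply: (e_uniq ezx); rewrite 1?(e_sym y) 1?(e_sym y').
Qed.

(* The new step function deletes from each dense pair of parts the rectangle cut
   out by one neighbourhood, which has many pairs but almost no edge. *)
Lemma refine_step : 4 * #|T| ^ 2 <= q * cnt (fun x y => e x y) ->
  exists (K' : finType) (f' : T -> K') (U' : rel K'),
    #|K'| = #|K| * 2 ^ #|K| ^ 2 /\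
    q ^ 4 * cnt (fun x y => U (f x) (f y) && e x y)
       + q ^ 3 * cnt (fun x y => U' (f' x) (f' y)) + #|T| ^ 2
    <= q ^ 4 * cnt (fun x y => U' (f' x) (f' y) && e x y) + q ^ 3 * cnt (fun x y => U (f x) (f y))
       + q ^ 4 * (#|K| ^ 2 * #|T|).
Proof.
move=> manyE.
(* The refined label stores all the bits [hit], so that the deleted rectangles become unions of
   pairs of new parts. *)
pose f' x := (f x, [ffun ij => hit ij.1 ij.2 x]) : K * {ffun K * K -> bool}.
pose U' (a b : K * {ffun K * K -> bool}) :=
  dense a.1 b.1 && ~~ (a.2 (a.1, b.1) && b.2 (a.1, b.1)).
exists (K * {ffun K * K -> bool})%type, f', U'.
split; first by rewrite card_prod card_ffun card_bool card_prod.
have U'E x y : U' (f' x) (f' y) = dense (f x) (f y) && ~~ hit2 x y.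
  by rewrite /U' /f' /= !ffunE.
have -> : cnt (fun x y => U' (f' x) (f' y) && e x y) =
    cnt (fun x y => (dense (f x) (f y) && e x y) && ~~ hit2 x y).
  by apply: eq_card => p; rewrite !inE U'E -!andbA [X in _ && X]andbC.
have -> : cnt (fun x y => U' (f' x) (f' y)) = cnt (fun x y => dense (f x) (f y) && ~~ hit2 x y).
  by apply: eq_card => p; rewrite !inE U'E.
have := dense_opt.
rewrite [cnt (fun x y => dense _ _ && e x y)](cnt_splitI _ hit2).
rewrite [cnt (fun x y => dense (f x) (f y))](cnt_splitI _ hit2).
have -> : cnt (fun x y => (dense (f x) (f y) && e x y) && hit2 x y) =
    cnt (fun x y => [&& dense (f x) (f y), hit2 x y & e x y]).
  by apply: eq_card => p; rewrite !inE -andbA [X in _ && X]andbC.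
have := hit_edges; have := hit_pairs; have := good_edges.
set g := cnt (fun x y => [&& _, _ & _]); set d := cnt _; set hp := cnt _; set he := cnt _.
set d' := cnt _; set e' := cnt _; set u := cnt _; set ue := cnt _.
(* Since [4 - 3 = 1], the good edges give [#|T| ^ 2 <= q * g <= q ^ 3 * hp]: this is the gain once
   [dense_opt] is multiplied by [q ^ 3]. The loss is [q ^ 4 * he]. *)
by move=> *; nia.
Qed.

End Refine.

(** Number of parts after [i] refinements of the trivial partition. *)
Fixpoint tower i := if i is i'.+1 then tower i' * 2 ^ tower i' ^ 2 else 1.

(** For [T] this large, the loss in each step is at most half of [#|T| ^ 2], so the doubled energy
    grows by at least [#|T| ^ 2]. *)
Lemma iterate_refine i : 4 * #|T| ^ 2 <= q * cnt (fun x y => e x y) ->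
  (forall j, j < i -> 2 * q ^ 4 * tower j ^ 2 <= #|T|) ->
  exists (K : finType) (f : T -> K) (U : rel K),
    #|K| = tower i /\
    i * #|T| ^ 2 + 2 * q ^ 3 * cnt (fun x y => U (f x) (f y)) <=
    2 * q ^ 4 * cnt (fun x y => U (f x) (f y) && e x y).
Proof.
move=> manyE; elim: i => [|i IHi] big.
  exists unit, (fun=> tt), (fun _ _ => false); split; first by rewrite card_unit.
  have -> : cnt (fun _ _ => false) = 0 by apply: eq_card0 => p; rewrite inE.
  by rewrite muln0.
have [j ji|K [f [U [cK IH]]]] := IHi _; first by apply: big; rewrite ltnS ltnW.
have [K' [f' [U' [cK' step]]]] := refine_step f U manyE.
exists K', f', U'; split; first by rewrite cK' cK.
have := big i (leqnn _); move: IH step; rewrite cK.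
set a := cnt _; set b := cnt _; set a' := cnt _; set b' := cnt _ => IH step.
move=> bigi; have {bigi} : 2 * q ^ 4 * tower i ^ 2 * #|T| <= #|T| ^ 2.
  by rewrite -[leqRHS]mulnn leq_mul2r bigi orbT.
have -> : 2 * q ^ 4 * tower i ^ 2 * #|T| = 2 * (q ^ 4 * (tower i ^ 2 * #|T|)) by rewrite !mulnA.
rewrite mulSn -!(mulnA 2); lia.
Qed.

End RuzsaSzemeredi.

Theorem ruzsa_szemeredi q : 0 < q -> exists N, forall (T : finType) (e : rel T),
  symmetric e -> (forall x y, e x y -> exists z, e z x && e z y) ->
  (forall x y z z', e x y -> e z x -> e z y -> e z' x -> e z' y -> z = z') ->
  N <= #|T| -> q * #|[set p : T * T | e p.1 p.2]| <= 4 * #|T| ^ 2.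
Proof.
(* The doubled energy never exceeds [I * #|T| ^ 2], so [I.+1] steps are impossible. The sum below
   dominates every size requirement, and its successor makes [T] nonempty. *)
move=> q0; pose I := 2 * q ^ 4.
exists (\sum_(j < I.+1) 2 * q ^ 4 * tower j ^ 2).+1 => T e e_sym e_tri e_uniq bigT.
rewrite leqNgt; apply/negP => /ltnW manyE.
have [|K [f [U [_ H]]]] := iterate_refine e_sym e_tri e_uniq manyE (i := I.+1).
  move=> j jI; apply: (leq_trans _ (ltnW bigT)).
  by rewrite (bigD1 (Ordinal jI)) //= leq_addr.
have : #|[set p : T * T | U (f p.1) (f p.2) && e p.1 p.2]| <= #|T| ^ 2.
  by rewrite -mulnn -card_prod max_card.
have : 0 < #|T| ^ 2 by rewrite expn_gt0 (leq_trans _ bigT).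
move: H; rewrite /= -/I; set c := #|[set p | _ && _]|; nia.
Qed.

(** * From packings to graphs in which every edge lies in a unique triangle *)

Section Packing.
Variables (n : nat) (H : {set {set {set 'I_n}}}) (t : {set {set 'I_n}} -> {set 'I_n}).
Hypothesis H_disj : trivIset H.
Hypothesis H_free : ~~ [exists D in copies (complete 3) n, rainbow H D].
Hypothesis t_card : forall C, C \in H -> #|t C| = 3.
Hypothesis t_edge : forall C x y, C \in H -> x \in t C -> y \in t C -> x != y -> [set x; y] \in C.

(* [t C] is the vertex set of a chosen triangle of the copy [C]. *)
Let owned x y := (x != y) && [exists C in H, (x \in t C) && (y \in t C)].

Lemma packing_owner C C' a : C \in H -> C' \in H -> a \in C -> a \in C' -> C = C'.
Proof.
move=> CH CH' aC aC'; apply/eqP/negPn/negP => ne.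
by have /pred0P/(_ a) := trivIsetP H_disj C C' CH CH' ne; rewrite /= aC aC'.
Qed.

Lemma ord3_cases (j : 'I_3) : [\/ j = inord 0, j = inord 1 | j = inord 2].
Proof.
case: j => -[|[|[|]]] // lj; [apply: Or31 | apply: Or32 | apply: Or33];
by apply: val_inj; rewrite /= inordK.
Qed.

Lemma triangle_copy (x y z : 'I_n) : x != y -> y != z -> x != z ->
  [set [set x; y]; [set y; z]; [set x; z]] \in copies (complete 3) n.
Proof.
move=> xy yz xz; pose g := [ffun i : 'I_3 => tnth [tuple x; y; z] i].
have g0 : g (inord 0) = x by rewrite ffunE (tnth_nth x) inordK.
have g1 : g (inord 1) = y by rewrite ffunE (tnth_nth x) inordK.
have g2 : g (inord 2) = z by rewrite ffunE (tnth_nth x) inordK.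
have i01 : inord 0 != inord 1 :> 'I_3 by rewrite -val_eqE /= !inordK.
have i02 : inord 0 != inord 2 :> 'I_3 by rewrite -val_eqE /= !inordK.
have i12 : inord 1 != inord 2 :> 'I_3 by rewrite -val_eqE /= !inordK.
apply/imsetP; exists g.
  rewrite inE; apply/injectiveP => i j.
  case: (ord3_cases i) (ord3_cases j) => -> [] ->; rewrite ?g0 ?g1 ?g2 // => /eqP;
  by rewrite ?(negPf xy) ?(negPf yz) ?(negPf xz) // eq_sym ?(negPf xy) ?(negPf yz) ?(negPf xz).
have in_edges (i j : 'I_3) : i != j -> [set g i; g j] \in
    [set g @: (a : {set complete 3}) | a in edges (complete 3)].
  move=> ij; apply/imsetP; exists [set i; j]; last by rewrite imsetU1 imset_set1.
  by apply/imsetP; exists (i, j); rewrite ?inE.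
apply/eqP; rewrite eqEsubset; apply/andP; split; apply/subsetP => a.
  rewrite !inE => /orP[/orP[]|] /eqP ->.
  - by rewrite -g0 -g1 in_edges.
  - by rewrite -g2 -g1 in_edges.
  - by rewrite -g0 -g2 in_edges.
case/imsetP => b /imsetP[[i j]]; rewrite inE /= => ij -> ->.
rewrite imsetU1 imset_set1 !inE.
case: (ord3_cases i) (ord3_cases j) ij => -> [] ->; rewrite ?eqxx // ?g0 ?g1 ?g2 => _;
by rewrite ?[[set y; x]]setUC ?[[set z; x]]setUC ?[[set z; y]]setUC eqxx ?orbT.
Qed.

(** If two of the three owners coincide, that copy already contains all three vertices; if they are
    pairwise distinct, the triangle is rainbow. *)
Lemma owned_triangle x y z : owned x y -> owned x z -> owned y z ->
  exists C, [/\ C \in H, x \in t C, y \in t C & z \in t C].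
Proof.
move=> /andP[xy /existsP[C1 /and3P[H1 x1 y1]]] /andP[xz /existsP[C2 /and3P[H2 x2 z2]]].
move=> /andP[yz /existsP[C3 /and3P[H3 y3 z3]]].
have [E12|N12] := eqVneq C1 C2; first by exists C1; split; rewrite ?x1 ?y1 ?E12.
have [E13|N13] := eqVneq C1 C3; first by exists C1; split; rewrite ?x1 ?y1 ?E13.
have [E23|N23] := eqVneq C2 C3; first by exists C2; split; rewrite ?x2 ?z2 ?E23.
case/negP: H_free; apply/existsP.
exists [set [set x; y]; [set y; z]; [set x; z]]; rewrite triangle_copy //=.
have e1 := t_edge H1 x1 y1 xy; have e2 := t_edge H2 x2 z2 xz; have e3 := t_edge H3 y3 z3 yz.
apply/andP; split.
  apply/subsetP => a; rewrite !inE => /orP[/orP[]|] /eqP ->; apply/bigcupP;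
  [by exists C1 | by exists C3 | by exists C2].
apply/forallP => C; apply/implyP => CH.
have own a b Ca Cb : Ca \in H -> Cb \in H -> a \in Ca -> b \in Cb -> Ca != Cb ->
    a \in C -> b \in C -> a = b.
  move=> Ha Hb aCa bCb ne aC bC.
  by rewrite (packing_owner Ha CH aCa aC) (packing_owner Hb CH bCb bC) eqxx in ne.
apply/card_le1_eqP => a b; rewrite !inE.
move=> /andP[aC /orP[/orP[]|] /eqP ?] /andP[bC /orP[/orP[]|] /eqP ?]; subst a b => //; symmetry.
- exact: (own _ _ C1 C3).
- exact: (own _ _ C1 C2).
- by apply: (own _ _ C3 C1) => //; rewrite eq_sym.
- by apply: (own _ _ C3 C2) => //; rewrite eq_sym.
- by apply: (own _ _ C2 C1) => //; rewrite eq_sym.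
- exact: (own _ _ C2 C3).
Qed.

Lemma owned_sym : symmetric owned.
Proof.
move=> x y; rewrite /owned eq_sym; congr andb.
by apply: eq_existsb => C; rewrite [X in _ && X]andbC.
Qed.

Lemma owned_in_triangle x y : owned x y -> exists z, owned z x && owned z y.
Proof.
case/andP => xy /existsP[C /and3P[CH xC yC]].
have : 0 < #|t C :\: [set x; y]|.
  rewrite cardsD t_card // subn_gt0 (leq_ltn_trans (subset_leq_card (subsetIr _ _))) //.
  by rewrite cards2 xy.
case/card_gt0P => z; rewrite !inE negb_or => /andP[/andP[zx zy] zC]; exists z.
by rewrite /owned zx zy; apply/andP; split; apply/existsP; exists C; rewrite CH zC.
Qed.

(** Both triangles belong to the copy owning the edge [xy], whose chosen triangle has only one
    further vertex. *)
Lemma owned_triangle_unique x y z z' :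
  owned x y -> owned z x -> owned z y -> owned z' x -> owned z' y -> z = z'.
Proof.
move=> exy ezx ezy ezx' ezy'.
have [|||C [CH xC yC zC]] := @owned_triangle x y z; rewrite ?(owned_sym _ z) //.
have [|||C' [CH' xC' yC' zC']] := @owned_triangle x y z'; rewrite ?(owned_sym _ z') //.
have xy : x != y by case/andP: exy.
have EC := packing_owner CH CH' (t_edge CH xC yC xy) (t_edge CH' xC' yC' xy).
have : #|t C :\: [set x; y]| <= 1.
  rewrite cardsD t_card // (setIidPr _) ?cards2 ?xy //.
  by apply/subsetP => w; rewrite !inE => /orP[] /eqP ->.
have ne a b : owned a b -> a != b by case/andP.
move/card_le1_eqP; apply; rewrite !inE negb_or ?EC ?zC' -?EC ?zC andbT;
by apply/andP; split; apply: ne.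
Qed.

Lemma packing_le_owned : #|H| <= #|[set p | owned p.1 p.2]|.
Proof.
(* [None] serves as a value outside [H], where no vertex need exist. *)
have P C : exists p : option ('I_n * 'I_n), C \in H ->
    exists x y, [/\ p = Some (x, y), x != y, x \in t C & y \in t C].
  case: (boolP (C \in H)) => [CH|]; last by exists None.
  have /card_gt1P[x [y [xC yC xy]]] : 1 < #|t C| by rewrite t_card.
  by exists (Some (x, y)) => _; exists x, y.
have [g gP] := fin_all_exists P.
rewrite -(card_in_imset (f := g)).
  rewrite -(card_imset [set p | owned p.1 p.2] (@Some_inj _)).
  apply/subset_leq_card/subsetP => _ /imsetP[C CH ->].
  have [x [y [-> xy xC yC]]] := gP C CH; apply: imset_f; rewrite inE /= /owned xy /=.
  by apply/existsP; exists C; rewrite CH xC.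
move=> C C' CH CH'; have [x [y [-> xy xC yC]]] := gP C CH.
have [x' [y' [-> _ xC' yC']]] := gP C' CH' => -[? ?]; subst x' y'.
exact: (packing_owner CH CH' (t_edge CH xC yC xy) (t_edge CH' xC' yC' xy)).
Qed.
End Packing.

Lemma multicolor_ex_upper (F : sgraph) (hgirth : has_girth F 3) q : 0 < q ->
  exists N, forall n, N <= n -> q * multicolor_ex F (complete 3) n <= 4 * n ^ 2.
Proof.
move=> q0; have [N rs] := ruzsa_szemeredi q0; exists N => n Nn.
have [[[|a [|b [|c [|]]]] // [_ /andP[/= adjs uabc]] _] _] := hgirth.
rewrite /multicolor_ex; elim/big_ind: _ => [|x y Hx Hy|H /and3P[Hc Hd Hf]].
- by rewrite muln0.
- by rewrite /maxn; case: ifP.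
have P C : exists t : {set 'I_n}, C \in H -> #|t| = 3 /\
    forall x y, x \in t -> y \in t -> x != y -> [set x; y] \in C.
  case: (boolP (C \in H)) => [/(subsetP Hc)/imsetP[f]|]; last by exists set0.
  rewrite inE => /injectiveP finj -> {C}.
  (* One fixed triangle [a b c] of [F] is carried into each copy by its embedding. *)
  exists (f @: [set a; b; c]) => _; split.
    rewrite card_imset // -setUA cardsU1 cards2 !inE; move: uabc; rewrite /= !inE.
    by case/and3P=> -> ->.
  move=> _ _ /imsetP[u ut ->] /imsetP[v vt ->] uv.
  apply/imsetP; exists [set u; v]; last by rewrite imsetU1 imset_set1.
  apply/imsetP; exists (u, v) => //; rewrite inE /=.
  move: adjs uv ut vt; rewrite !inE (inj_eq finj) => /and4P[ab bc ca _] +.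
  move=> + /orP[/orP[]|] /eqP ? /orP[/orP[]|] /eqP ?;
  by subst u v; rewrite ?eqxx // ?[adj b a]adj_sym ?[adj c b]adj_sym ?[adj a c]adj_sym.
have [t tP] := fin_all_exists P.
have tc C : C \in H -> #|t C| = 3 by move=> CH; case: (tP C CH).
have te C x y : C \in H -> x \in t C -> y \in t C -> x != y -> [set x; y] \in C.
  by move=> CH; case: (tP C CH) => _; apply.
have := rs _ _ (owned_sym H t) (owned_in_triangle tc) (owned_triangle_unique Hd Hf tc te).
rewrite card_ord => /(_ Nn); apply: leq_trans; rewrite leq_mul2l; apply/orP; right.
exact: packing_le_owned.
Qed.

(** * Strict convexity of spheres *)

Section Sphere.
Local Open Scope ring_scope.

(** Rests on the identity [|pa + qb|^2 + pq |a - b|^2 = (p + q)(p |a|^2 + q |b|^2)]. It is valid for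
    all signs, so [c] need not lie between [a] and [b]. *)
Lemma sphere_strictly_convex (R : realDomainType) (I : finType) (p q : R) (a b c : I -> R) (s : R) :
  p != 0 -> q != 0 -> (forall i, p * a i + q * b i = (p + q) * c i) ->
  \sum_i a i ^+ 2 = s -> \sum_i b i ^+ 2 = s -> \sum_i c i ^+ 2 = s -> a =1 b.
Proof.
move=> p0 q0 abc sa sb sc.
have E : \sum_i (p * a i + q * b i) ^+ 2 + p * q * \sum_i (a i - b i) ^+ 2 =
    (p + q) * (p * \sum_i a i ^+ 2 + q * \sum_i b i ^+ 2).
  by rewrite !mulr_sumr -!big_split /= mulr_sumr; apply: eq_bigr => i _; ring.
have : p * q * \sum_i (a i - b i) ^+ 2 = 0.
  move: E; rewrite (eq_bigr (fun i => (p + q) ^+ 2 * c i ^+ 2)); last first.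
    by move=> i _; rewrite abc exprMn.
  rewrite -mulr_sumr sa sb sc; set S := \sum_i _ => E.
  have -> : p * q * S = (p + q) ^+ 2 * s + p * q * S - (p + q) ^+ 2 * s by ring.
  by rewrite E; ring.
move/eqP; rewrite !mulf_eq0 (negPf p0) (negPf q0) /= psumr_eq0 => [/allP H i|i _];
  last exact: sqr_ge0.
by have := H i (mem_index_enum _); rewrite /= sqrf_eq0 subr_eq0 => /eqP.
Qed.
End Sphere.

Lemma set2_eq (T : finType) (x y u v : T) : x != y -> [set x; y] = [set u; v] ->
  (x = u /\ y = v) \/ (x = v /\ y = u).
Proof.
move=> xy E; have := set21 x y; have := set22 x y; rewrite E !inE.
move=> /orP[] /eqP yE /orP[] /eqP xE; move: xy; rewrite xE yE ?eqxx //; by [right|left].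
Qed.

(** * Behrend-type construction of a packing *)

Section Behrend.
Variables (F : sgraph) (d L n : nat).
Hypothesis fits : #|F| * (#|F| * L) ^ d <= n.
Local Notation vec := {ffun 'I_d -> 'I_L}.

Lemma position_bound (x a : 'I_L) (v : F) : x + enum_rank v * a < #|F| * L.
Proof.
apply: (@leq_trans ((enum_rank v).+1 * L)); last by rewrite leq_mul2r ltn_ord orbT.
by rewrite mulSn -addSn leq_add // leq_mul2l ltnW ?orbT.
Qed.

(* The vertex [v] of the copy indexed by [(x, a)] sits at [x + (rank v) a], in a
   grid private to [v]. *)
Definition position (x a : vec) (v : F) : F * {ffun 'I_d -> 'I_(#|F| * L)} :=
  (v, [ffun i => Ordinal (position_bound (x i) (a i) v)]).

Lemma card_grid : #|{: F * {ffun 'I_d -> 'I_(#|F| * L)}}| <= n.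
Proof. by rewrite card_prod card_ffun !card_ord. Qed.

Definition place (x a : vec) (v : F) : 'I_n := widen_ord card_grid (enum_rank (position x a v)).

(** The grid point records the vertex of [F], so two copies can meet only in images of the same
    vertex. *)
Lemma place_eq x a x' a' u v : place x a u = place x' a' v ->
  u = v /\ forall i, x i + enum_rank u * a i = x' i + enum_rank u * a' i :> nat.
Proof.
move/(congr1 val) => /= /ord_inj/enum_rank_inj[<- /ffunP E]; split=> // i.
by have := congr1 val (E i); rewrite !ffunE.
Qed.

Lemma place_inj x a : injective (place x a).
Proof. by move=> u v /place_eq[]. Qed.

Definition lattice_copy (x a : vec) : {set {set 'I_n}} :=
  [set place x a @: (b : {set F}) | b in edges F].

Lemma lattice_copy_copies x a : lattice_copy x a \in copies F n.
Proof.
apply/imsetP; exists (finfun (place x a)).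
  by rewrite inE; apply/injectiveP => u v; rewrite !ffunE => /place_inj.
by apply: eq_imset => b; apply: eq_imset => v; rewrite ffunE.
Qed.

Lemma mem_lattice_copy x a (b : {set 'I_n}) : b \in lattice_copy x a ->
  exists u v, adj u v /\ b = [set place x a u; place x a v].
Proof.
case/imsetP => s /imsetP[[u v]]; rewrite inE /= => uv -> ->.
by exists u, v; rewrite imsetU1 imset_set1.
Qed.

Lemma mem_lattice_copy2 x a (y z : 'I_n) : y != z -> [set y; z] \in lattice_copy x a ->
  exists u v, [/\ adj u v, y = place x a u & z = place x a v].
Proof.
move=> yz /mem_lattice_copy[u [v [uv]]] /(set2_eq yz)[[-> ->]|[-> ->]]; first by exists u, v.
by exists v, u; rewrite adj_sym.
Qed.

Lemma adj_neq (u v : F) : adj u v -> u != v.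
Proof. by apply: contraTneq => ->; rewrite adj_irrefl. Qed.

Lemma rank_neq (u v : F) : adj u v -> nat_of_ord (enum_rank u) <> enum_rank v.
Proof. by move/adj_neq/eqP => uv /ord_inj/enum_rank_inj. Qed.

Lemma vec_eq (x a x' a' : vec) (u v : nat) : u <> v ->
  (forall i, x i + u * a i = x' i + u * a' i :> nat) ->
  (forall i, x i + v * a i = x' i + v * a' i :> nat) -> x = x' /\ a = a'.
Proof.
move=> uv Eu Ev.
have aE i : a i = a' i :> nat by have := Eu i; have := Ev i; nia.
by split; apply/ffunP => i; apply: val_inj => //=; have := Eu i; rewrite aE => /addIn.
Qed.

(** A common edge gives two common points at different ranks, and two points of a progression
    determine its start and its step. Hence the copies are edge-disjoint. *)
Lemma lattice_copy_meet x a x' a' b :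
  b \in lattice_copy x a -> b \in lattice_copy x' a' -> x = x' /\ a = a'.
Proof.
move=> /mem_lattice_copy[u [v [uv ->]]] H.
have ne : place x a u != place x a v by rewrite (inj_eq (@place_inj x a)) adj_neq.
have [u' [v' [_ /place_eq[_ Eu] /place_eq[_ Ev]]]] := mem_lattice_copy2 ne H.
exact: vec_eq (rank_neq uv) Eu Ev.
Qed.

Hypothesis F_edge : exists u v : F, adj u v.

Lemma lattice_copy_inj x a x' a' : lattice_copy x a = lattice_copy x' a' -> x = x' /\ a = a'.
Proof.
have [u [v uv]] := F_edge => E.
have H : [set place x a u; place x a v] \in lattice_copy x a.
  apply/imsetP; exists [set u; v]; last by rewrite imsetU1 imset_set1.
  by apply/imsetP; exists (u, v); rewrite ?inE.
by apply: (lattice_copy_meet H); rewrite -E.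
Qed.

Definition sqnorm (a : vec) := \sum_i a i ^ 2.
Definition sphere_family R := [set lattice_copy p.1 p.2 | p : vec * vec & sqnorm p.2 == R].

Lemma sphere_family_rainbow_free R :
  ~~ [exists D in copies (complete 3) n, rainbow (sphere_family R) D].
Proof.
apply/negP => /existsP[D /andP[/imsetP[g]]].
rewrite inE => /injectiveP ginj DE /andP[/subsetP Dcov /forallP Dcol].
pose g' := g : 'I_3 -> 'I_n.
have inD (i j : 'I_3) : i != j -> [set g' i; g' j] \in D.
  move=> ij; rewrite DE; apply/imsetP; exists [set i; j]; last by rewrite imsetU1 imset_set1.
  by apply/imsetP; exists (i, j); rewrite ?inE.
have gne (i j : 'I_3) : i != j -> g' i != g' j by rewrite (inj_eq ginj).
have cov (i j : 'I_3) : i != j -> exists x a u v,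
    [/\ [/\ lattice_copy x a \in sphere_family R,
            [set g' i; g' j] \in lattice_copy x a & sqnorm a = R], adj u v,
     g' i = place x a u & g' j = place x a v].
  move=> ij; have /bigcupP[C CH bC] := Dcov _ (inD _ _ ij).
  have /imsetP[[x a]] := CH; rewrite inE /= => /eqP aR EC.
  rewrite EC in CH bC; have [u [v [uv gi gj]]] := mem_lattice_copy2 (gne _ _ ij) bC.
  by exists x, a, u, v.
pose i0 : 'I_3 := inord 0; pose i1 : 'I_3 := inord 1; pose i2 : 'I_3 := inord 2.
have n01 : i0 != i1 by rewrite -val_eqE /= !inordK.
have n02 : i0 != i2 by rewrite -val_eqE /= !inordK.
have n12 : i1 != i2 by rewrite -val_eqE /= !inordK.
have [x1 [a1 [u [v [[C1 b1 R1] uv gu1 gv1]]]]] := cov _ _ n01.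
have [x2 [a2 [v' [w [[C2 b2 R2] vw gv2 gw2]]]]] := cov _ _ n12.
have [x3 [a3 [u' [w' [[C3 b3 R3] uw gu3 gw3]]]]] := cov _ _ n02.
(* At each corner two copies meet, hence at the same vertex of [F]: the triangle comes from a
   triangle [u v w] of [F]. *)
have [? Eu] : _ /\ _ := place_eq (etrans (esym gu1) gu3); subst u'.
have [? Ev] : _ /\ _ := place_eq (etrans (esym gv1) gv2); subst v'.
have [? Ew] : _ /\ _ := place_eq (etrans (esym gw2) gw3); subst w'.
have {}uv := rank_neq uv; have {}vw := rank_neq vw; have {}uw := rank_neq uw.
(* The coefficients [v - u], [w - v], [w - u] satisfy
   [(v - u) a1 + (w - v) a2 = (w - u) a3]. *)
have a12 : a1 = a2.
  pose p : int := (enum_rank v)%:Z - (enum_rank u)%:Z.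
  pose q : int := (enum_rank w)%:Z - (enum_rank v)%:Z.
  have sq (a : vec) : sqnorm a = R -> (\sum_i (a i)%:Z ^+ 2 = R%:Z)%R.
    by move=> <-; rewrite /sqnorm -natz natr_sum; apply: eq_bigr => i _; rewrite natrX natz.
  have p0 : (p != 0)%R by apply/eqP; lia.
  have q0 : (q != 0)%R by apply/eqP; lia.
  apply/ffunP => i; apply/val_inj.
  suff /(_ i)[] : (fun i => Posz (a1 i)) =1 (fun i => Posz (a2 i)) by [].
  apply: (sphere_strictly_convex p0 q0 _ (sq _ R1) (sq _ R2) (sq _ R3)) => j.
  by rewrite /p /q; have := Eu j; have := Ev j; have := Ew j; nia.
subst a2.
(* With equal steps, the common point at [v] makes the starts equal; one copy then holds two edges
   of [D], against rainbowness. *)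
have x12 : x1 = x2 by apply/ffunP => i; apply: val_inj; have /= /addIn := Ev i.
subst x2.
have Cle : #|lattice_copy x1 a1 :&: D| <= 1 by have := Dcol (lattice_copy x1 a1); rewrite C1.
have /setP/(_ (g' i0)) : [set g' i0; g' i1] = [set g' i1; g' i2].
  by apply: (card_le1_eqP Cle); rewrite inE ?b1 ?b2 inD.
by rewrite !inE eqxx (negPf (gne _ _ n01)) (negPf (gne _ _ n02)).
Qed.

Lemma sphere_family_packing R : rainbow_free_packing F (complete 3) (sphere_family R).
Proof.
apply/and3P; split; last exact: sphere_family_rainbow_free.
  by apply/subsetP => _ /imsetP[p _ ->]; apply: lattice_copy_copies.
apply/trivIsetP => _ _ /imsetP[p _ ->] /imsetP[p' _ ->] ne.
apply/pred0P => b /=; apply/negP => /andP[bp bp'].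
by have [E1 E2] := lattice_copy_meet bp bp'; rewrite E1 E2 eqxx in ne.
Qed.

Lemma card_sphere_family R : #|sphere_family R| = L ^ d * #|[set a | sqnorm a == R]|.
Proof.
rewrite card_in_imset => [|[x a] [x' a'] _ _ /= /lattice_copy_inj[-> ->]] //.
rewrite -[L in L ^ d](card_ord L) -[d in _ ^ d](card_ord d) -card_ffun -cardsT -cardsX.
by apply: eq_card => -[x a]; rewrite !inE.
Qed.

(** Pigeonhole: the squared norm takes values below [d * L ^ 2] on [L ^ d] vectors. *)
Lemma popular_norm : 0 < d -> 0 < L -> exists R, L ^ d <= d * L ^ 2 * #|[set a | sqnorm a == R]|.
Proof.
move=> d0 L0.
have lt (a : vec) : sqnorm a < d * L ^ 2.
  apply: (@leq_ltn_trans (\sum_(i < d) L.-1 ^ 2)).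
    by apply: leq_sum => i _; rewrite leq_sqr -ltnS prednK.
  by rewrite sum_nat_const card_ord ltn_pmul2l // ltn_sqr prednK.
have M0 : 0 < #|'I_(d * L ^ 2)| by rewrite card_ord muln_gt0 d0 expn_gt0 L0.
pose N (R : 'I_(d * L ^ 2)) := #|[set a | sqnorm a == R]|.
have [R ER] : {R | \max_R N R = N R} := bigop.eq_bigmax N M0.
exists (val R); rewrite -/(N R).
have maxR S : N S <= N R by rewrite -ER bigop.leq_bigmax.
rewrite -[L in L ^ d](card_ord L) -[d in _ ^ d](card_ord d) -card_ffun -sum1_card.
rewrite (partition_big (fun a => Ordinal (lt a)) xpredT) //= -[d * L ^ 2 in leqRHS]card_ord.
rewrite -sum_nat_const; apply: leq_sum => S _.
rewrite sum1_card; apply: leq_trans (maxR S); apply: eq_leq.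
by apply: eq_card => a; rewrite [RHS]inE.
Qed.

Lemma behrend_bound : 0 < d -> 0 < L ->
  L ^ (2 * d) <= d * L ^ 2 * multicolor_ex F (complete 3) n.
Proof.
move=> d0 L0; have [R HR] := popular_norm d0 L0.
have : #|sphere_family R| <= multicolor_ex F (complete 3) n.
  by apply: leq_bigmax_cond; apply: sphere_family_packing.
rewrite card_sphere_family mul2n -addnn expnD => H.
apply: leq_trans (leq_mul (leqnn _) HR) _.
by rewrite mulnCA leq_mul2l H orbT.
Qed.
End Behrend.

(** With side [L = 2 ^ d] and [d] maximal such that the grid fits, [d] is of order at most the
    square root of [log n], and all losses are absorbed by [K ^ d]. *)
Lemma multicolor_ex_lower (F : sgraph) : (exists u v : F, adj u v) ->
  exists K N, 0 < K /\ forall n, N <= n -> exists d,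
    2 ^ (d ^ 2) <= n /\ n ^ 2 <= K ^ d * multicolor_ex F (complete 3) n.
Proof.
move=> Fe; set r := #|F|.
have r0 : 0 < r by have [u _] := Fe; apply/card_gt0P; exists u.
(* The exponents come from [2d + 4 <= 6d] for [r], and from [4d + 2 <= 6d], [d <= 2 ^ d] and the
   factor [L ^ 2] for 2. The threshold is the grid size for [d = 1], which secures [d > 0]. *)
exists (2 ^ 9 * r ^ 6), (r * (r * 2 ^ 1) ^ 1); split.
  by rewrite muln_gt0 !expn_gt0 r0.
move=> n Nn; pose P d := r * (r * 2 ^ d) ^ d <= n.
have big d : 2 ^ (d ^ 2) <= r * (r * 2 ^ d) ^ d.
  by rewrite expnMn -expnM mulnn mulnA leq_pmull // muln_gt0 expn_gt0 r0.
have bnd d : P d -> d <= n.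
  move=> Pd; apply: leq_trans (leq_trans (big d) Pd).
  have d2 : d <= 2 ^ d by apply/ltnW/ltn_expl.
  by apply: leq_trans d2 _; rewrite leq_exp2l //; nia.
have exP : exists d, P d by exists 1.
case: (ex_maxnP exP bnd) => d Pd dmax; exists d.
have d0 : 0 < d by apply: dmax.
split; first exact: leq_trans (big d) Pd.
have := behrend_bound Pd Fe d0; rewrite expn_gt0 /= => /(_ isT).
set m := multicolor_ex _ _ _ => lower.
(* Maximality of [d]: the next grid no longer fits. *)
have upper : n <= r * (r * 2 ^ d.+1) ^ d.+1.
  by apply: ltnW; rewrite ltnNge; apply/negP => /dmax; rewrite ltnn.
apply: (@leq_trans ((r * (r * 2 ^ d.+1) ^ d.+1) ^ 2)); first by rewrite leq_sqr.
have -> : (r * (r * 2 ^ d.+1) ^ d.+1) ^ 2 = r ^ (2 * d + 4) * 2 ^ (4 * d + 2) * (2 ^ d) ^ (2 * d).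
  rewrite !(expnMn, =^~ expnM) mulnA -!expnD -mulnA -expnD.
  by congr (_ ^ _ * _ ^ _); nia.
apply: leq_trans (leq_mul (leqnn _) lower) _.
rewrite mulnA leq_mul2r; apply/orP; right.
have -> : (2 ^ 9 * r ^ 6) ^ d = r ^ (6 * d) * 2 ^ (6 * d) * 2 ^ d * (2 ^ d) ^ 2.
  by rewrite !(expnMn, =^~ expnM) mulnC -!mulnA -!expnD; congr (_ * _ ^ _); nia.
rewrite [leqLHS]mulnA leq_mul2r; apply/orP; right; apply: leq_mul; last by apply/ltnW/ltn_expl.
by apply: leq_mul; rewrite leq_pexp2l //; nia.
Qed.

(** * Translation into asymptotic bounds over the reals *)

Unset Implicit Arguments.
From mathcomp Require Import all_classical all_reals all_analysis.
Import numFieldNormedType.Exports.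
Local Open Scope classical_set_scope.
Local Open Scope ring_scope.

Lemma exponent_bound (R : realType) (d n : nat) : (2 ^ (d ^ 2) <= n)%N ->
  d%:R <= Num.sqrt (ln (2 : R))^-1 * Num.sqrt (ln (n%:R : R)).
Proof.
move=> dn; have ln2 : 0 < ln (2 : R) by rewrite ln_gt0 // ltr1n.
have n0 : (0 < n)%N by apply: leq_trans dn; rewrite expn_gt0.
rewrite -sqrtrM ?invr_ge0 ?(ltW ln2) //.
have -> : d%:R = Num.sqrt (d%:R ^+ 2) :> R by rewrite sqrtr_sqr ger0_norm.
rewrite ler_wsqrtr // ler_pdivlMl //.
rewrite mulrC -natrX mulr_natl -lnXn // ler_ln ?posrE ?ltr0n //.
  by rewrite -natrX ler_nat.
Qed.

Theorem theorem1p4 (R : realType) (F : sgraph) (hconn : connected_graph F)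
    (hgirth : has_girth F 3) :
  (exists2 h : nat -> R,
     h =O_\oo (fun n : nat => Num.sqrt (ln (n%:R : R))) &
     \forall n \near \oo,
       n%:R ^+ 2 * expR (- h n) <= (multicolor_ex F (complete 3) n)%:R) /\
  (fun n : nat => (multicolor_ex F (complete 3) n)%:R : R)
    =o_\oo (fun n : nat => n%:R ^+ 2 : R).
Proof.
split.
  have Fe : exists u v : F, adj u v.
    by have [[[|u [|v s]] // [_ /andP[/andP[uv _] _]] _] _] := hgirth; exists u, v.
  have [K [N [K0 lower]]] := multicolor_ex_lower Fe.
  (* [K ^ d] is the exponential of [d * ln K], and [exponent_bound] bounds this exponent by [c]
     times the square root of [ln n]. *)
  pose c := ln (K%:R : R) * Num.sqrt (ln (2 : R))^-1.
  have lnK0 : 0 <= ln (K%:R : R) by rewrite ln_ge0 // ler1n.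
  exists (fun n => c * Num.sqrt (ln n%:R)).
    apply/eqOP; near=> k.
    have ck : c <= k by near: k; apply: nbhs_pinfty_ge; rewrite num_real.
    near=> n.
    rewrite normrM ler_wpM2r // ger0_norm ?mulr_ge0 ?sqrtr_ge0.
  near=> n; have [d [dn ub]] : exists d, (2 ^ (d ^ 2) <= n)%N /\
      (n ^ 2 <= K ^ d * multicolor_ex F (complete 3) n)%N.
    by apply: lower; near: n; exact: nbhs_infty_ge.
  rewrite expRN ler_pdivrMr ?expR_gt0 //.
  rewrite -natrX; apply: (@le_trans _ _ ((K ^ d)%:R * (multicolor_ex F (complete 3) n)%:R)).
    by rewrite -natrM ler_nat.
  rewrite mulrC ler_wpM2l // natrX -[X in X ^+ d]lnK ?posrE ?ltr0n //.
  rewrite -expRM_natl ler_expR -mulrA mulrC ler_wpM2l //.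
  exact: exponent_bound.
apply/eqoP => eps eps0.
(* The integer [q] is the least one above [4 / eps], so that [4 / q] is below [eps]. *)
have [N upper] := multicolor_ex_upper hgirth (ltn0Sn (Num.truncn (4 / eps))).
near=> n.
rewrite !ger0_norm ?exprn_ge0 //.
have Nn : (N <= n)%N by near: n; exact: nbhs_infty_ge.
have := upper n Nn; rewrite -(ler_nat R) natrM (natrM _ 4) natrX => H.
rewrite -(ler_pM2l (ltr0Sn R (Num.truncn (4 / eps)))) (le_trans H) //.
rewrite [leRHS]mulrA ler_wpM2r ?exprn_ge0 //.
rewrite -ler_pdivrMr // ltW //.
by have := truncnS_gt (4 / eps).
Unshelve. all: by end_near.
Qed.
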